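(* Let $\alpha\in(0,1)$ and set $l=\frac{1-\alpha}{1+\alpha}$. Define $$\gamma=\sqrt[3]{\frac{4(1-l^2)}{l^4}},\qquad b=\sqrt{1+\gamma}+\frac12\sqrt{8-4\gamma+\frac{8(2-l^2)}{l^2\sqrt{1+\gamma}}},\qquad a=\frac14(b-1)^2,$$ and $$f_\alpha(z)=z\,\frac{az^2+b}{(a+b-1)z^2+1}.$$ Then $$f_\alpha\left(\left[\frac{1-\alpha}{1+\alpha},\,1\right]\right)\subseteq\left[\frac{1-\alpha'}{1+\alpha'},\,1\right]\qquad\text{for}\qquad \alpha'=\alpha^{2+(1-\alpha)^{-1/2}} .$$
   Context: All roots are real (nonnegative) roots. *)

(* Defs.v *)
From Stdlib Require Import Reals Rtopology.
Open Scope R_scope.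

Definition ell (alpha : R) : R := (1 - alpha) / (1 + alpha).

(* The cube root is written with [Rpower], which is the usual real power only
   at a positive base; for 0 < alpha < 1 we have 0 < ell alpha < 1, so the
   base is positive here. *)
Definition gamma (alpha : R) : R :=
  let l := ell alpha in
  Rpower (4 * (1 - l ^ 2) / l ^ 4) (1 / 3).

Definition b_coef (alpha : R) : R :=
  let l := ell alpha in
  let g := gamma alpha in
  sqrt (1 + g)
  + 1 / 2 * sqrt (8 - 4 * g + 8 * (2 - l ^ 2) / (l ^ 2 * sqrt (1 + g))).

Definition a_coef (alpha : R) : R := 1 / 4 * (b_coef alpha - 1) ^ 2.

Definition f_alpha (alpha z : R) : R :=
  let a := a_coef alpha in
  let b := b_coef alpha in
  z * ((a * z ^ 2 + b) / ((a + b - 1) * z ^ 2 + 1)).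

Definition alpha' (alpha : R) : R :=
  Rpower alpha (2 + Rpower (1 - alpha) (- (1 / 2))).

Definition Icc (x y : R) : R -> Prop := fun z => x <= z <= y.

(* Main.v *)
Require Import Defs.
From Stdlib Require Import Reals Rtopology Lra Psatz.
Open Scope R_scope.

(** Put [s = (b - 1) / 2] and [z = (1 - x) / (1 + x)]. Since [a = s^2],
    [(1 - f z) / (1 + f z) = (1 - z) / (1 + z) * ((1 - s z) / (1 + s z))^2
                           = (y (t - y^2) / (1 - t y^2))^2]
    where [x = y^2] and [t = (s - 1) / (s + 1)]. Hence [f z <= 1], and the lower
    bound asks for the maximum of [y (t - y^2) / (1 - t y^2)] in absolute value
    on [0, k], where [k^2 = alpha].

    The closed formula makes [b] the unique positive root of
    [b^4 - 6 b^2 - 8 c b - 3], [c = (2 - l^2) / l^2], which encodes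
    equioscillation: [t = 2 p k - p^2], where the interior maximum [p] solves
    [k (1 - p^4) = 2 p (1 - k^2 p^2)], and both extreme values equal [k p^2].
    With [S = sqrt (1 - alpha)] one finds [p <= k / (1 + S)], so that
    [(k p^2)^2 <= alpha^3 / (1 + S)^4 <= alpha^(2 + 1 / S)]. *)

(** * The quartic behind the closed formula for [b] *)

(* Ferrari's factorisation: [b] is a root of
   [b^2 - 2 y b + 2 y^2 - 3 - 2 c / y], which divides the quartic because
   [c^2 = g^3 + 1]. *)
Lemma ferrari_root (g c : R) :
  0 < g -> 0 < c -> c ^ 2 = g ^ 3 + 1 ->
  let b := sqrt (1 + g) + 1 / 2 * sqrt (8 - 4 * g + 8 * c / sqrt (1 + g)) in
  0 < b /\ b ^ 4 - 6 * b ^ 2 - 8 * c * b - 3 = 0.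
Proof.
intros Hg Hc Hcg b.
set (y := sqrt (1 + g)) in *.
assert (Hy : 0 < y) by (apply sqrt_lt_R0; lra).
assert (Hyy : y ^ 2 = 1 + g) by (apply pow2_sqrt; lra).
(* [sqrt] is 0 at negative arguments, so [w ^ 2] is the radicand only once its sign is known. The
   bound comes from [(g - 2) ^ 2 * (1 + g) = g ^ 3 - 3 * g ^ 2 + 4 <= 4 * (g ^ 3 + 1)]. *)
assert (Harg : 0 <= 8 - 4 * g + 8 * c / y).
{ assert (Hq : g - 2 <= 2 * (c / y)).
  { set (q := c / y).
    assert (Hq0 : 0 < q) by (apply Rdiv_lt_0_compat; lra).
    assert (Hqc : q ^ 2 * (1 + g) = g ^ 3 + 1)
      by (rewrite <- Hyy, <- Hcg; unfold q; field; lra).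
    assert (Hsq : (g - 2) ^ 2 <= (2 * q) ^ 2).
    { apply Rmult_le_reg_r with (1 + g); [lra |].
      replace ((2 * q) ^ 2 * (1 + g)) with (4 * (q ^ 2 * (1 + g))) by ring.
      rewrite Hqc. assert (0 < g ^ 3) by (apply pow_lt; lra). nra. }
    nra. }
  unfold Rdiv in *. lra. }
set (w := sqrt (8 - 4 * g + 8 * c / y)) in *.
assert (Hw0 : 0 <= w) by apply sqrt_pos.
assert (Hw : w ^ 2 = 8 - 4 * g + 8 * c / y) by (apply pow2_sqrt; exact Harg).
split; [unfold b; lra |].
assert (Hb : b ^ 2 - 2 * y * b + 2 * y ^ 2 - 3 - 2 * c / y = 0).
{ transitivity (w ^ 2 / 4 + y ^ 2 - 3 - 2 * c / y).
  - unfold b. field. lra.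
  - rewrite Hw, Hyy. field. lra. }
assert (Hconst : (2 * y ^ 2 - 3) ^ 2 - 4 * c ^ 2 / y ^ 2 = - 3)
  by (rewrite Hcg, Hyy; field; lra).
transitivity ((b ^ 2 - 2 * y * b + 2 * y ^ 2 - 3 - 2 * c / y)
              * (b ^ 2 + 2 * y * b + 2 * y ^ 2 - 3 + 2 * c / y)
              - ((2 * y ^ 2 - 3) ^ 2 - 4 * c ^ 2 / y ^ 2) - 3).
- field. lra.
- rewrite Hb, Hconst. ring.
Qed.

(** Cross-multiplying the two equations eliminates [c]. The cofactor of [x - y] is a sum of
    nonnegative terms that vanishes only if [x = y]. *)
Lemma quartic_root_unique (c x y : R) :
  0 < x -> 0 < y ->
  x ^ 4 - 6 * x ^ 2 - 8 * c * x - 3 = 0 ->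
  y ^ 4 - 6 * y ^ 2 - 8 * c * y - 3 = 0 -> x = y.
Proof.
intros Hx Hy Ex Ey.
assert (E : (x - y) * (x * y * (x - y) ^ 2 + 3 * (x * y - 1) ^ 2) = 0).
{ transitivity (y * (x ^ 4 - 6 * x ^ 2 - 8 * c * x - 3)
                - x * (y ^ 4 - 6 * y ^ 2 - 8 * c * y - 3)).
  - ring.
  - rewrite Ex, Ey. ring. }
assert (Hxy : 0 < x * y) by nra.
destruct (Rmult_integral _ _ E) as [H | H]; [lra |].
assert (Hsq : 0 <= (x - y) ^ 2) by apply pow2_ge_0.
assert (Hsq1 : 0 <= (x * y - 1) ^ 2) by apply pow2_ge_0.
assert (Hz : (x - y) ^ 2 = 0) by nra.
nra.
Qed.

Lemma ell_bounds (alpha : R) : 0 < alpha < 1 -> 0 < ell alpha < 1.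
Proof.
intros H. unfold ell. split.
- apply Rdiv_lt_0_compat; lra.
- apply Rmult_lt_reg_r with (1 + alpha); [lra |].
  unfold Rdiv. rewrite Rmult_assoc, Rinv_l; lra.
Qed.

Lemma b_coef_root (alpha : R) :
  0 < alpha < 1 ->
  let b := b_coef alpha in
  let c := (2 - ell alpha ^ 2) / ell alpha ^ 2 in
  0 < b /\ b ^ 4 - 6 * b ^ 2 - 8 * c * b - 3 = 0.
Proof.
intros Halpha b c.
destruct (ell_bounds alpha Halpha) as [Hl0 Hl1].
set (l := ell alpha) in *.
assert (Hl2 : 0 < l ^ 2 < 1) by nra.
assert (Hl4 : 0 < l ^ 4) by (apply pow_lt; lra).
assert (Hbase : 0 < 4 * (1 - l ^ 2) / l ^ 4) by (apply Rdiv_lt_0_compat; lra).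
assert (Hg : 0 < gamma alpha) by apply exp_pos.
assert (Hg3 : gamma alpha ^ 3 = 4 * (1 - l ^ 2) / l ^ 4).
{ rewrite <- Rpower_pow by exact Hg. unfold gamma. fold l.
  rewrite Rpower_mult. replace (1 / 3 * INR 3) with 1 by (simpl; field).
  apply Rpower_1, Hbase. }
assert (Hc : 0 < c) by (apply Rdiv_lt_0_compat; lra).
assert (Hcg : c ^ 2 = gamma alpha ^ 3 + 1)
  by (rewrite Hg3; unfold c; field; lra).
assert (Hb : b = sqrt (1 + gamma alpha)
  + 1 / 2 * sqrt (8 - 4 * gamma alpha + 8 * c / sqrt (1 + gamma alpha))).
{ assert (Hy : 0 < sqrt (1 + gamma alpha)) by (apply sqrt_lt_R0; lra).
  unfold b, b_coef. fold l. do 4 f_equal. unfold c. field. lra. }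
rewrite Hb. apply ferrari_root; assumption.
Qed.

(** * Equioscillation on [[0, k]] *)

(** With [t = 2 p k - p^2], the equation says that [y (t - y^2) / (1 - t y^2)] equals [k p^2] at [p]
    and [- k p^2] at [k]. The intermediate value theorem applies: the difference [F] of the two
    sides is [k] at 0 and negative at [k / (1 + S)]. *)
Lemma extremal_point (k S : R) :
  0 < k -> 0 < S < 1 -> k ^ 2 + S ^ 2 = 1 ->
  exists p, 0 < p <= k / (1 + S)
    /\ k * (1 - p ^ 4) = 2 * p * (1 - k ^ 2 * p ^ 2).
Proof.
intros Hk HS HkS.
set (F := fun p => k * (1 - p ^ 4) - 2 * p * (1 - k ^ 2 * p ^ 2)).
assert (HP : 0 < k / (1 + S)) by (apply Rdiv_lt_0_compat; lra).
assert (HF0 : F 0 = k) by (unfold F; ring).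
assert (HFP : F (k / (1 + S)) <= 0).
{ assert (HP2 : (k / (1 + S)) ^ 2 = (1 - S) / (1 + S)).
  { transitivity (k ^ 2 / (1 + S) ^ 2); [field; lra |].
    replace (k ^ 2) with (1 - S ^ 2) by lra. field. lra. }
  assert (E : F (k / (1 + S)) = - (2 * k * S ^ 2 * (1 - S) / (1 + S) ^ 2)).
  { unfold F.
    replace ((k / (1 + S)) ^ 4) with (((k / (1 + S)) ^ 2) ^ 2) by ring.
    rewrite HP2. replace (k ^ 2) with (1 - S ^ 2) by lra. field. lra. }
  rewrite E.
  assert (0 < 2 * k * S ^ 2 * (1 - S) / (1 + S) ^ 2); [| lra].
  apply Rdiv_lt_0_compat; [| nra].
  repeat apply Rmult_lt_0_compat; try lra; nra. }
assert (Hcont : continuity F) by (unfold F; reg).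
destruct (IVT_cor F 0 (k / (1 + S)) Hcont) as [p [Hp Ep]]; [lra | nra |].
exists p. unfold F in Ep. repeat split; [| lra | lra].
destruct (Rle_lt_or_eq_dec 0 p (proj1 Hp)) as [H | H]; [exact H |].
exfalso. rewrite <- H in Ep. fold (F 0) in Ep. lra.
Qed.

(** The right side is [2 s + 1] with [s = (1 + t) / (1 - t)]. It is positive and satisfies the
    quartic of [b_coef alpha], so uniqueness identifies the two. *)
Lemma b_coef_equioscillation (alpha k p : R) :
  0 < alpha < 1 -> k ^ 2 = alpha -> 0 < k -> 0 < p <= k ->
  k * (1 - p ^ 4) = 2 * p * (1 - k ^ 2 * p ^ 2) ->
  let t := 2 * p * k - p ^ 2 in
  b_coef alpha = (3 + t) / (1 - t).
Proof.
intros Halpha Hka Hk Hp Ep t.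
assert (Hk1 : k < 1) by nra.
assert (Ht : 0 < t < 1) by (unfold t; nra).
destruct (b_coef_root alpha Halpha) as [Hb Eb].
set (c := (2 - ell alpha ^ 2) / ell alpha ^ 2) in *.
apply quartic_root_unique with c; [exact Hb | | exact Eb |].
- apply Rdiv_lt_0_compat; lra.
(* This is the quartic rewritten in [t] and [k]. Right side minus left side is the equation for [p]
   times the cofactor in [H]. *)
- assert (Hrel : 4 * t * (1 - k ^ 2) ^ 2 = (3 + t) * (1 - t) ^ 3 * k ^ 2).
  { assert (H : (k * (1 - p ^ 4) - 2 * p * (1 - k ^ 2 * p ^ 2))
      * (- 8 * p * k ^ 4 + 12 * p ^ 2 * k ^ 3 - 6 * p ^ 3 * k ^ 2
         + (p ^ 4 + 3) * k - 2 * p) = 0) by (rewrite Ep; ring).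
    unfold t. nra. }
  assert (Hc : 8 * (c - 1) = 64 * k ^ 2 / (1 - k ^ 2) ^ 2).
  { unfold c, ell. rewrite <- Hka. field. lra. }
  assert (Ht4 : 0 < (1 - k ^ 2) ^ 2) by (apply pow_lt; lra).
  (* At [c = 1] the quartic is [(b - 3) (b + 1)^3], which gives the first term. *)
  transitivity (256 * t / (1 - t) ^ 4 - 8 * (c - 1) * ((3 + t) / (1 - t)));
    [field; lra |].
  rewrite Hc.
  transitivity (64 / ((1 - t) ^ 4 * (1 - k ^ 2) ^ 2)
    * (4 * t * (1 - k ^ 2) ^ 2 - (3 + t) * (1 - t) ^ 3 * k ^ 2)).
  + field. split; lra.
  + rewrite Hrel. ring.
Qed.

(* The two one-sided bounds are the factorisations
   [k p^2 (1 - t y^2) - y (t - y^2) = (y - p)^2 (y + k)] and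
   [k p^2 (1 - t y^2) + y (t - y^2) = (k - y) (y + p)^2]. *)
Lemma equioscillation_bound (k p y : R) :
  0 < p -> 0 <= y <= k ->
  k * (1 - p ^ 4) = 2 * p * (1 - k ^ 2 * p ^ 2) ->
  let t := 2 * p * k - p ^ 2 in
  (y * (t - y ^ 2)) ^ 2 <= (k * p ^ 2 * (1 - t * y ^ 2)) ^ 2.
Proof.
intros Hp Hy Ep t.
assert (Hkt : k * p ^ 2 * t = 2 * p - k) by (unfold t; nra).
assert (E : k * p ^ 2 * (1 - t * y ^ 2) = k * p ^ 2 - (2 * p - k) * y ^ 2)
  by (rewrite <- Hkt; ring).
rewrite E.
assert (Hm : 0 <= (y - p) ^ 2 * (y + k))
  by (apply Rmult_le_pos; [apply pow2_ge_0 | lra]).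
assert (Hq : 0 <= (k - y) * (y + p) ^ 2)
  by (apply Rmult_le_pos; [lra | apply pow2_ge_0]).
apply pow_maj_Rabs, Rabs_le. unfold t. lra.
Qed.

(* Logarithmically, [(1 / S - 1) * - ln alpha <= S / (1 + S) <= ln (1 + S)]. *)
Lemma alpha'_lower_bound (alpha S : R) :
  0 < alpha < 1 -> 0 < S < 1 -> S ^ 2 = 1 - alpha ->
  alpha ^ 3 / (1 + S) ^ 4 <= alpha' alpha.
Proof.
intros Ha HS HSa.
assert (HrS : Rpower (1 - alpha) (- (1 / 2)) = / S).
{ rewrite Rpower_Ropp. unfold Rdiv. rewrite Rmult_1_l, Rpower_sqrt by lra.
  rewrite <- HSa, sqrt_pow2 by lra. reflexivity. }
assert (Hlna : - ln alpha <= / alpha - 1).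
{ pose proof (exp_ineq1_le (- ln alpha)) as H.
  rewrite exp_Ropp, exp_ln in H by lra. lra. }
assert (HlnS : 1 - / (1 + S) <= ln (1 + S)).
{ pose proof (exp_ineq1_le (- ln (1 + S))) as H.
  rewrite exp_Ropp, exp_ln in H by lra. lra. }
assert (HS1 : 0 < / S - 1).
{ assert (E : / S - 1 = (1 - S) / S) by (field; lra).
  rewrite E. apply Rdiv_lt_0_compat; lra. }
assert (Hlog : (/ S - 1) * - ln alpha <= ln (1 + S)).
{ apply Rle_trans with ((/ S - 1) * (/ alpha - 1)).
  - apply Rmult_le_compat_l; lra.
  - replace ((/ S - 1) * (/ alpha - 1)) with (1 - / (1 + S)); [exact HlnS |].
    replace alpha with (1 - S ^ 2) by lra. field. nra. }
assert (HlnS0 : 0 < 1 - / (1 + S)).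
{ assert (E : 1 - / (1 + S) = S / (1 + S)) by (field; lra).
  rewrite E. apply Rdiv_lt_0_compat; lra. }
unfold alpha'. rewrite HrS.
rewrite <- (Rpower_pow 3 alpha), <- (Rpower_pow 4 (1 + S)) by lra.
unfold Rdiv. rewrite <- Rpower_Ropp. unfold Rpower. rewrite <- exp_plus.
(* The exponents compare as [(/ S - 1) * - ln alpha < 4 * ln (1 + S)], which follows from [Hlog] and
   [ln (1 + S) > 0]. *)
apply Rlt_le, exp_increasing. simpl INR. lra.
Qed.

(** * Transfer to [f_alpha] *)

(** Since [(1 - f) / (1 + f) = M / P], the two bounds amount to [0 <= M <= A * P]. *)
Lemma f_alpha_bounds (alpha t A z : R) :
  0 < alpha < 1 -> 0 < A -> 0 <= t < 1 -> 0 < z <= 1 ->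
  b_coef alpha = (3 + t) / (1 - t) ->
  let x := (1 - z) / (1 + z) in
  x * (t - x) ^ 2 <= A * (1 - t * x) ^ 2 ->
  (1 - A) / (1 + A) <= f_alpha alpha z <= 1.
Proof.
intros Halpha HA Ht Hz Hb x Hx.
set (s := (1 + t) / (1 - t)).
assert (Hs : 0 < s) by (apply Rdiv_lt_0_compat; lra).
assert (Hbs : b_coef alpha = 2 * s + 1) by (rewrite Hb; unfold s; field; lra).
set (M := (1 - z) * (1 - s * z) ^ 2).
set (P := (1 + z) * (1 + s * z) ^ 2).
assert (Hsz : 0 < s * z) by nra.
assert (HM : 0 <= M) by (apply Rmult_le_pos; [lra | apply pow2_ge_0]).
assert (HP : 0 < P) by (apply Rmult_lt_0_compat; [lra | apply pow_lt; lra]).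
assert (Hf : f_alpha alpha z = (P - M) / (P + M)).
{ unfold f_alpha, a_coef. rewrite Hbs.
  assert (E : P + M = 2 * ((s ^ 2 + 2 * s) * z ^ 2 + 1)) by (unfold P, M; ring).
  unfold M, P in *. field. nra. }
assert (HMP : M <= A * P).
(* The factor [q] turns [M] and [P] into the two expressions in [x] of the hypothesis. *)
{ set (q := (1 - t) ^ 2 / (1 + z) ^ 3).
  assert (Hq : 0 < q) by (apply Rdiv_lt_0_compat; apply pow_lt; lra).
  apply Rmult_le_reg_l with q; [exact Hq |].
  replace (q * M) with (x * (t - x) ^ 2)
    by (unfold q, M, x, s; field; lra).
  replace (q * (A * P)) with (A * (1 - t * x) ^ 2)
    by (unfold q, P, x, s; field; lra).
  exact Hx. }
rewrite Hf. split.
- apply Rmult_le_reg_r with ((1 + A) * (P + M)); [nra |].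
  replace ((1 - A) / (1 + A) * ((1 + A) * (P + M))) with ((1 - A) * (P + M))
    by (field; lra).
  replace ((P - M) / (P + M) * ((1 + A) * (P + M))) with ((P - M) * (1 + A))
    by (field; lra).
  lra.
- apply Rmult_le_reg_r with (P + M); [lra |].
  unfold Rdiv. rewrite Rmult_assoc, Rinv_l; lra.
Qed.

Theorem proposition3p14 (alpha : R) (halpha : 0 < alpha < 1) :
  included
    (image_dir (f_alpha alpha) (Icc ((1 - alpha) / (1 + alpha)) 1))
    (Icc ((1 - alpha' alpha) / (1 + alpha' alpha)) 1).
Proof.
intros w [z [-> [Hz1 Hz2]]].
set (k := sqrt alpha). set (S := sqrt (1 - alpha)).
assert (Hk : 0 < k) by (apply sqrt_lt_R0; lra).
assert (Hka : k ^ 2 = alpha) by (apply pow2_sqrt; lra).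
assert (HS0 : 0 < S) by (apply sqrt_lt_R0; lra).
assert (HSa : S ^ 2 = 1 - alpha) by (apply pow2_sqrt; lra).
assert (HS : 0 < S < 1) by nra.
destruct (extremal_point k S Hk HS) as [p [Hp Ep]]; [lra |].
assert (HP : k / (1 + S) * (1 + S) = k) by (field; lra).
assert (Hpk : p <= k) by nra.
set (t := 2 * p * k - p ^ 2).
assert (Ht : 0 <= t < 1) by (unfold t; nra).
pose proof (ell_bounds alpha halpha) as Hl. unfold ell in Hl.
set (x := (1 - z) / (1 + z)).
(* The map [z -> (1 - z) / (1 + z)] is a decreasing involution that exchanges [ell alpha] with
   [alpha] and 1 with 0. *)
assert (Hx : 0 <= x <= alpha).
{ split.
  - apply Rmult_le_pos; [lra |]. apply Rlt_le, Rinv_0_lt_compat. lra.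
  - apply Rmult_le_reg_r with (1 + z); [lra |].
    unfold x, Rdiv. rewrite Rmult_assoc, Rinv_l by lra.
    apply Rmult_le_compat_r with (r := 1 + alpha) in Hz1; [| lra].
    unfold Rdiv in Hz1. rewrite Rmult_assoc, Rinv_l in Hz1 by lra. lra. }
set (A := alpha' alpha).
assert (HA : (k * p ^ 2) ^ 2 <= A).
{ apply Rle_trans with (alpha ^ 3 / (1 + S) ^ 4).
  - replace (alpha ^ 3 / (1 + S) ^ 4) with (k ^ 2 * (k / (1 + S)) ^ 4)
      by (rewrite <- Hka; field; lra).
    rewrite Rpow_mult_distr, <- pow_mult. simpl Nat.mul.
    apply Rmult_le_compat_l; [apply pow2_ge_0 |].
    apply pow_incr. lra.
  - apply alpha'_lower_bound; assumption. }
apply f_alpha_bounds with t; try lra.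
- apply exp_pos.
- apply b_coef_equioscillation; try assumption; lra.
- fold x.
  assert (Hy : sqrt x ^ 2 = x) by (apply pow2_sqrt; lra).
  assert (Hyk : 0 <= sqrt x <= k)
    by (split; [apply sqrt_pos | apply sqrt_le_1; lra]).
  pose proof (equioscillation_bound k p (sqrt x) (proj1 Hp) Hyk Ep) as H.
  cbv zeta in H. fold t in H. rewrite Hy in H.
  rewrite Rpow_mult_distr, Hy in H.
  apply Rle_trans with (1 := H). rewrite Rpow_mult_distr.
  apply Rmult_le_compat_r; [apply pow2_ge_0 | exact HA].
Qed.
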